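(* Let $X$ be a real normed linear space, $\Gamma\subset X^*$, and $x^*\in X^*$. Then the following statements are equivalent: (1) $x^*$ is positive relative to $\Gamma$. (2) $x^*$ is negative relative to $\Gamma$. (3) $\Gamma_\ominus\subset (x^* )_\ominus$. (4) $x^*$ belongs to the weak$^*$ closure of $\mathrm{cone}(\Gamma)$. Moreover, if $X$ is reflexive, then each of these statements is equivalent to (5) $x^*$ belongs to the norm closure $\overline{\mathrm{cone}}(\Gamma)$ of $\mathrm{cone}(\Gamma)$.
   Context: All linear spaces are real; $X^*$ is the dual space of $X$. For $\Gamma\subset X^*$, an element $x^*\in X^*$ is positive relative to $\Gamma$ if, whenever $x\in X$ satisfies $y^*(x)\ge 0$ for all $y^*\in\Gamma$, one has $x^*(x)\ge 0$; it is negative relative to $\Gamma$ if, whenever $x\in X$ satisfies $y^*(x)\le 0$ for all $y^*\in\Gamma$, one has $x^*(x)\le 0$. The dual cone in $X$ of $\Gamma\subset X^*$ is $\Gamma_\ominus:=\{x\in X\mid y^*(x)\le 0 \text{ for all } y^*\in\Gamma\}$, and $(x^* )_\ominus:=\{x^*\}_\ominus$. The conical hull $\mathrm{cone}(S)$ of a set $S$ is the smallest convex cone containing $S$, i.e. $\mathrm{cone}(S)=\{\sum_{i=1}^n\rho_i s_i\mid \rho_i\ge 0,\ s_i\in S,\ n<\infty\}$ (convex cones contain $0$). *)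

(* Defs.v *)
From HB Require Import structures.
From mathcomp Require Import all_boot all_order all_algebra.
From mathcomp Require Import all_classical all_reals all_analysis.

Set Implicit Arguments.
Unset Strict Implicit.
Unset Printing Implicit Defensive.

Import Order.TTheory GRing.Theory Num.Theory.
Import numFieldNormedType.Exports.

Local Open Scope classical_set_scope.
Local Open Scope ring_scope.

Section DualSpace.
Context (R : realType) (X : normedModType R).

Definition continuous_linear : {pred X -> R^o} :=
  fun f => `[< linear f /\ continuous f >].

Lemma continuous_linear_submod : submod_closed continuous_linear.
Proof.
split.
  apply/asboolP; split; last exact: cst_continuous.
  by move=> a x y; rewrite /= scaler0 addr0.
move=> a f g /asboolP[lf cf] /asboolP[lg cg]; apply/asboolP; split.
  move=> b x y; rewrite -[LHS]/(a *: f (b *: x + y) + g (b *: x + y)).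
  rewrite -[RHS]/(b *: (a *: f x + g x) + (a *: f y + g y)).
  by rewrite lf lg !scalerDr !scalerA (mulrC a b) addrACA.
move=> x; apply: (@cvgD R R^o); last exact: cg.
by apply: (@cvgZ R R^o); [exact: cvg_cst|exact: cf].
Qed.

HB.instance Definition _ := GRing.isSubmodClosed.Build R (X -> R^o)
  continuous_linear continuous_linear_submod.

(* X^*, with its operator norm [dual_norm] as the canonical norm, so that
   [closure] on [dual_space X] is the norm closure. *)
Record dual_space := DualSpace {
  dual_fun :> X -> R^o;
  dual_funP : dual_fun \in continuous_linear }.

HB.instance Definition _ := [isSub for dual_fun].
HB.instance Definition _ := [Choice of dual_space by <:].
HB.instance Definition _ := [SubChoice_isSubLmodule of dual_space by <:].


Lemma dual_linear (f : dual_space) : linear f.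
Proof. by have /asboolP[] := dual_funP f. Qed.

Lemma dual_continuous (f : dual_space) : continuous f.
Proof. by have /asboolP[] := dual_funP f. Qed.

HB.instance Definition _ (f : dual_space) :=
  GRing.isLinear.Build R X R^o *:%R f (dual_linear f).

Lemma dualD (f g : dual_space) (x : X) : (f + g) x = f x + g x.
Proof. by []. Qed.

Lemma dualZ (a : R) (f : dual_space) (x : X) : (a *: f) x = a * f x.
Proof. by []. Qed.

Definition dual_norm (f : dual_space) : R :=
  sup [set `|f x| | x in [set x : X | `|x| <= 1]].

Lemma dual_norm_has_sup (f : dual_space) :
  has_sup [set `|f x| | x in [set x : X | `|x| <= 1]].
Proof.
split; first by exists `|f 0|; exists 0 => //=; rewrite normr0.
have /bounded_funP/(_ 1)[M fM] :=
  (linear_bounded_continuous f).2 (@dual_continuous f).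
by exists M => _ [x x1 <-]; exact: fM.
Qed.

Lemma le_dual_norm (f : dual_space) (x : X) : `|x| <= 1 -> `|f x| <= dual_norm f.
Proof.
by move=> x1; apply: ub_le_sup; [case: (dual_norm_has_sup f)|exists x].
Qed.

Lemma dual_norm_le (f : dual_space) (M : R) :
  (forall x, `|x| <= 1 -> `|f x| <= M) -> dual_norm f <= M.
Proof.
move=> fM; apply: ge_sup; first by case: (dual_norm_has_sup f).
by move=> _ [x x1 <-]; exact: fM.
Qed.

Lemma dual_normD (f g : dual_space) : dual_norm (f + g) <= dual_norm f + dual_norm g.
Proof.
apply: dual_norm_le => x x1; rewrite dualD (le_trans (ler_normD _ _))//.
by rewrite lerD// le_dual_norm.
Qed.

Lemma dual_norm_ge0 (f : dual_space) : 0 <= dual_norm f.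
Proof. by rewrite (le_trans _ (@le_dual_norm f 0 _)) ?normr0. Qed.

Lemma dual_normZ (a : R) (f : dual_space) : dual_norm (a *: f) = `|a| * dual_norm f.
Proof.
have le_normZ b g : dual_norm (b *: g) <= `|b| * dual_norm g.
  apply: dual_norm_le => x x1; rewrite dualZ normrM ler_wpM2l//.
  exact: le_dual_norm.
apply/eqP; rewrite eq_le le_normZ /=.
have [->|a0] := eqVneq a 0; first by rewrite normr0 mul0r dual_norm_ge0.
rewrite -ler_pdivlMl ?normr_gt0// -normfV.
by rewrite (le_trans _ (le_normZ _ _))// scalerA mulVf// scale1r.
Qed.

Lemma dual_fun_bound (f : dual_space) (x : X) : `|f x| <= dual_norm f * `|x|.
Proof.
have [->|x0] := eqVneq x 0; first by rewrite linear0 !normr0 mulr0.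
have nx0 : 0 < `|x| by rewrite normr_gt0.
have /(@le_dual_norm f) : `| `|x|^-1 *: x| <= 1.
  by rewrite normrZ normfV normr_id mulVf ?gt_eqF.
by rewrite linearZ/= normrM normfV normr_id ler_pdivrMl// mulrC.
Qed.

Lemma dual_norm_eq0 (f : dual_space) : dual_norm f = 0 -> f = 0.
Proof.
move=> f0; apply/val_inj/funext => x /=.
by apply/eqP; rewrite -normr_le0; have := dual_fun_bound f x; rewrite f0 mul0r.
Qed.

HB.instance Definition _ := Lmodule_isNormed.Build R dual_space
  dual_normD dual_normZ dual_norm_eq0.

End DualSpace.

Section Notions.
Context (R : realType) (X : normedModType R).
Implicit Types (f : dual_space X) (G A : set (dual_space X)).

Lemma evaluation_continuous_linear (x : X) :
  (fun f => f x : R^o) \in @continuous_linear R (dual_space X).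
Proof.
have ev_lin : linear (fun f => f x : R^o) by [].
apply/asboolP; split=> //.
pose ev : {linear dual_space X -> R^o} :=
  HB.pack (fun f => f x : R^o) (GRing.isLinear.Build _ _ _ _ _ ev_lin).
apply/(linear_bounded_continuous ev)/bounded_funP => r.
exists (r * `|x|) => f fr.
by rewrite (le_trans (dual_fun_bound f x))// ler_wpM2r.
Qed.

Definition canonical_embedding (x : X) : dual_space (dual_space X) :=
  DualSpace (evaluation_continuous_linear x).

(* Only surjectivity is required: by Hahn-Banach the canonical embedding is
   always an isometry. *)
Definition reflexive_space : Prop := range canonical_embedding = setT.

(* X^* seen inside R^X with the product topology: the coarsest topology making
   every evaluation at a point of X continuous. *)
Definition weak_star : Type :=
  initial_topology (fun f => (f : X -> R^o) : {ptws X -> R^o}).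

HB.instance Definition _ := Uniform.on weak_star.

Definition weak_star_closure A : set (dual_space X) :=
  closure (A : set weak_star).

(* n = 0 is allowed: the cone contains 0, and cone set0 = [set 0]. *)
Definition cone (V : lmodType R) (S : set V) : set V :=
  [set v | exists (n : nat) (rho : 'I_n -> R) (s : 'I_n -> V),
     [/\ forall i, 0 <= rho i, forall i, S (s i) &
         v = \sum_(i < n) rho i *: s i]].

Definition positive_relative G f : Prop :=
  forall x : X, (forall g, G g -> 0 <= g x) -> 0 <= f x.

Definition negative_relative G f : Prop :=
  forall x : X, (forall g, G g -> g x <= 0) -> f x <= 0.

Definition dual_cone G : set X := [set x | forall g, G g -> g x <= 0].

End Notions.

(* Main.v *)
Require Import Defs.
From HB Require Import structures.
From mathcomp Require Import all_boot all_order all_algebra.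
From mathcomp Require Import all_classical all_reals all_analysis.
From mathcomp Require Import lra.
Import Order.TTheory GRing.Theory Num.Theory.
Import numFieldNormedType.Exports.
Local Open Scope classical_set_scope.
Local Open Scope ring_scope.

(** Positivity, negativity and the inclusion of dual cones are three readings of
    one condition: [xstar] is nonpositive wherever all of [Gamma] is (replacing
    [x] by [- x] exchanges the signs). Everything rests on comparing it with
    membership in a closure of [cone Gamma].

    Membership in a closure implies this condition, because evaluation at [x]
    is continuous for both topologies: the functionals that are nonpositive at
    [x] form a closed set containing the cone ([closure_le0]).

    The converse is separation of a point from a convex cone in a normed space
    ([separate_cone]): outside the closure there is a continuous linear form
    [F], nonpositive on the cone and positive at the point. Whenever [F] is
    evaluation at some [x] of [X], this [x] contradicts the condition.
    - In the dual space with its norm, reflexivity of [X] says that every [F] is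
      such an evaluation ([closure_cone_of_reflexive]).
    - For the weak* topology, a neighbourhood of [xstar] only controls the values
      at finitely many points of [X] ([weak_star_nbhs]). Sending a functional to
      the row of these values moves the problem to a finite-dimensional space,
      where every linear form comes from a linear combination of the points,
      that is, from evaluation at a single point of [X]
      ([weak_star_closure_cone]).

    Separation is obtained from the Mazur-Orlicz form of the Hahn-Banach theorem
    ([mazur_orlicz]): a linear form below a sublinear functional [p] can be
    subjected to a convex cone of further constraints [f v <= c], provided each
    of them is compatible with [p]. No extension from subspaces is involved: the
    constraints are absorbed into [p] by an infimal convolution, and below any
    sublinear functional Zorn's lemma provides a minimal one, which is linear. *)

(** * Convex cones *)

Section ConvexCone.
Context {R : realType}.

Definition convex_cone {V : lmodType R} (C : set V) :=
  [/\ C 0, forall u v, C u -> C v -> C (u + v) &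
      forall a u, 0 <= a -> C u -> C (a *: u)].

Lemma cone_convex {V : lmodType R} (S : set V) : convex_cone (cone S).
Proof.
split.
- by exists 0, (fun=> 0), (fun=> 0); split=> [||]; [case|case|rewrite big_ord0].
- move=> _ _ [m [r [s [r0 Ss ->]]]] [n [r' [s' [r0' Ss' ->]]]].
  exists (m + n)%N.
  exists (fun i => match fintype.split i with inl j => r j | inr j => r' j end).
  exists (fun i => match fintype.split i with inl j => s j | inr j => s' j end).
  split=> [i|i|]; [by case: fintype.split|by case: fintype.split|].
  rewrite big_split_ord/=; congr (_ + _); apply: eq_bigr => i _.
    by rewrite (unsplitK (inl i)).
  by rewrite (unsplitK (inr i)).
- move=> a _ a0 [n [r [s [r0 Ss ->]]]].
  exists n, (fun i => a * r i), s; split=> // [i|]; first exact: mulr_ge0.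
  by rewrite scaler_sumr; apply: eq_bigr => i _; rewrite scalerA.
Qed.

Lemma sub_cone {V : lmodType R} (S : set V) : S `<=` cone S.
Proof.
move=> v Sv; exists 1, (fun=> 1), (fun=> v); split=> //.
by rewrite big_ord1 scale1r.
Qed.

End ConvexCone.

(** * Sublinear functionals and the Mazur-Orlicz theorem *)

Section Sublinear.
Context {R : realType} {V : lmodType R}.
Implicit Types (p q : V -> R) (K : set (V * R^o)).

(** Homogeneity is asked as an inequality, the form that infima preserve;
    equality follows in [sublinearZ]. *)
Definition sublinear p :=
  (forall x y, p (x + y) <= p x + p y) /\
  (forall a x, 0 <= a -> p (a *: x) <= a * p x).

Lemma sublinear0 {p} : sublinear p -> p 0 = 0.
Proof.
move=> [pD pZ]; apply/eqP; rewrite eq_le; apply/andP; split.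
  by have := pZ 0 0 (lexx 0); rewrite scale0r mul0r.
by have := pD 0 0; rewrite addr0 lerDl.
Qed.

Lemma sublinearZ {p a} x : sublinear p -> 0 <= a -> p (a *: x) = a * p x.
Proof.
move=> sp; rewrite le0r => /predU1P[->|a0].
  by rewrite scale0r mul0r sublinear0.
apply/eqP; rewrite eq_le (sp.2 _ _ (ltW a0)) /= -ler_pdivlMl//.
rewrite -{1}(scale1r x) -(mulVf (lt0r_neq0 a0)) -scalerA.
by rewrite sp.2// invr_ge0 ltW.
Qed.

Lemma sublinear_ge_oppr {p} x : sublinear p -> - p (- x) <= p x.
Proof.
by move=> sp; have := sp.1 x (- x); rewrite subrr (sublinear0 sp) -lerBlDr sub0r.
Qed.

(** A pair [(v, c)] of [K] stands for the constraint [f v <= c] on a linear form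
    [f]. Together with [f <= p] it gives [f x = f (x - v) + f v <= p (x - v) + c],
    and [infconv p K x] is the best of these bounds on [f x]. *)
Definition infconv p K x := inf [set p (x - u.1) + u.2 | u in K].

Section InfConv.
Context {p K}.
Hypotheses (sp : sublinear p) (coneK : convex_cone K).
(* Compatibility of each constraint with p, since 0 = f (- v) + f v; this is what
   keeps the infima finite. *)
Hypothesis pK : forall u, K u -> 0 <= p (- u.1) + u.2.

Let values_lbound x : has_lbound [set p (x - u.1) + u.2 | u in K].
Proof.
exists (- p (- x)) => _ [u Ku <-].
have := sp.1 (x - u.1) (- x); rewrite addrAC subrr add0r.
by have := pK u Ku; lra.
Qed.

Let values_neq0 x : [set p (x - u.1) + u.2 | u in K] !=set0.
Proof. by have [K0 _ _] := coneK; exists (p (x - 0) + 0); exists (0, 0). Qed.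

Lemma infconv_le {x} u : K u -> infconv p K x <= p (x - u.1) + u.2.
Proof. by move=> Ku; apply: ge_inf => //; exists u. Qed.

Lemma infconv_ge (x : V) (y : R) :
  (forall u, K u -> y <= p (x - u.1) + u.2) -> y <= infconv p K x.
Proof. by move=> yp; apply: lb_le_inf => // _ [u Ku <-]; exact: yp. Qed.

Lemma infconv_sublinear : sublinear (infconv p K).
Proof.
have [K0 KD KZ] := coneK; split=> [x y|a x].
  rewrite -lerBlDr; apply: infconv_ge => u Ku.
  rewrite lerBlDr [leRHS]addrC -lerBlDr.
  apply: infconv_ge => v Kv; rewrite lerBlDr.
  rewrite (le_trans (infconv_le _ (KD u v Ku Kv)))//=.
  rewrite opprD addrACA [leRHS]addrC [leRHS]addrACA lerD2r//.
  exact: sp.1.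
rewrite le0r => /predU1P[->|a0].
  rewrite scale0r mul0r (le_trans (infconv_le _ K0))//= subrr addr0.
  by rewrite sublinear0.
rewrite -ler_pdivrMl//; apply: infconv_ge => u Ku; rewrite ler_pdivrMl//.
rewrite (le_trans (infconv_le _ (KZ _ _ (ltW a0) Ku)))//=.
by rewrite -scalerBr mulrDr lerD2r sp.2// ltW.
Qed.

Lemma infconv_le_base x : infconv p K x <= p x.
Proof.
have [K0 _ _] := coneK.
by rewrite (le_trans (infconv_le _ K0))//= subr0 addr0.
Qed.

Lemma infconv_le_graph u : K u -> infconv p K u.1 <= u.2.
Proof. by move=> /infconv_le/le_trans; apply; rewrite subrr sublinear0// add0r. Qed.

End InfConv.

Definition sublinear_minimal p :=
  sublinear p /\ forall q, sublinear q -> (forall x, q x <= p x) -> q = p.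

(** Absorbing into [p] the constraint that a linear form attain [p] at [y] gives
    a sublinear functional below [p], hence [p] itself by minimality. Its defining
    infimum then yields [p x <= p (x + y) - p y], the inequality missing for
    additivity. *)
Lemma sublinear_minimal_linear p :
  sublinear_minimal p -> linear (p : V -> R^o).
Proof.
move=> [sp pmin].
have pD x y : p (x + y) = p x + p y.
  apply/eqP; rewrite eq_le sp.1/=.
  (* The pairs (- (t *: y), - (t * p y)) ask a linear form to agree with p at y;
     absorbing them keeps p minimal, hence unchanged. *)
  pose K : set (V * R^o) :=
    [set (- (t *: y), - (t * p y)) | t in [set t : R | 0 <= t]].
  have coneK : convex_cone K.
    split.
    - by exists 0 => //=; rewrite scale0r mul0r !oppr0.
    - move=> _ _ [s s0 <-] [t t0 <-]; exists (s + t); first exact: addr_ge0.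
      by rewrite scalerDl mulrDl !opprD.
    - move=> a _ a0 [t t0 <-]; exists (a * t); first exact: mulr_ge0.
      rewrite -[RHS]/(a *: - (t *: y), a * - (t * p y)).
      by rewrite scalerN mulrN scalerA mulrA.
  have pK u : K u -> 0 <= p (- u.1) + u.2.
    by move=> [t t0 <-]; rewrite opprK sublinearZ// subrr.
  have eq_infconv : infconv p K = p.
    apply: pmin; first exact: infconv_sublinear.
    by move=> z; exact: infconv_le_base.
  have Ky : K (- y, - p y) by exists 1; rewrite /= ?ler01// scale1r mul1r.
  have := infconv_le sp pK (x := x) _ Ky.
  by rewrite eq_infconv /= opprK lerBrDr.
have pN x : p (- x) = - p x.
  by apply/eqP; rewrite -addr_eq0 -pD addNr sublinear0.
move=> a x y; rewrite pD; congr (_ + _).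
have [a0|a0] := leP 0 a; first exact: sublinearZ.
rewrite -[a]opprK scaleNr pN sublinearZ ?oppr_ge0 ?(ltW a0)//.
by rewrite scaleNr.
Qed.

(** Zorn's lemma applies because pointwise infima of chains remain sublinear: to
    bound the infimum at [x + y] by values of two members of the chain, at [x] and
    at [y], the smaller of the two serves for both. All functionals below [p] are
    bounded below by [x |-> - p (- x)], so the infima are finite. *)
Lemma sublinear_minimal_exists p : sublinear p ->
  exists2 q, sublinear_minimal q & forall x, q x <= p x.
Proof.
move=> sp.
pose T := {q | sublinear q /\ forall x, q x <= p x}.
pose le_fun (s t : T) := `[< forall x, sval t x <= sval s x >].
have [||||[q [sq qp]] qmax] := @Zorn T le_fun.
- by move=> t; apply/asboolP.
- move=> r s t /asboolP rs /asboolP st; apply/asboolP => x.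
  exact: le_trans (st x) (rs x).
- move=> [s sP] [t tP] /asboolP/= st /asboolP/= ts.
  have eq_st : s = t by apply/funext => x; apply/eqP; rewrite eq_le st ts.
  by subst t; congr exist; exact: Prop_irrelevance.
- move=> A Atot; have [[q0 Aq0]|A0] := pselect (A !=set0); last first.
    exists (exist _ p (conj sp (fun x => lexx _))) => s As.
    by case: A0; exists s.
  pose S x := [set sval t x | t in A].
  have Slb x : has_lbound (S x).
    exists (- p (- x)) => _ [[q [sq qp]] Aq <-] /=.
    by rewrite (le_trans _ (sublinear_ge_oppr _ sq))// lerN2.
  have Sle x t : A t -> inf (S x) <= sval t x.
    by move=> At; apply: ge_inf => //; exists t.
  have leS x y : (forall t, A t -> y <= sval t x) -> y <= inf (S x).
    move=> yt; apply: lb_le_inf; first by exists (sval q0 x); exists q0.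
    by move=> _ [t At <-]; exact: yt.
  have sS : sublinear (fun x => inf (S x)).
    split=> [x y|a x a0].
      rewrite -lerBlDr; apply: (leS) => s As.
      rewrite lerBlDr [leRHS]addrC -lerBlDr.
      apply: (leS) => t At; rewrite lerBlDr.
      have [/asboolP st|/asboolP ts] := Atot _ _ As At.
        rewrite (le_trans (Sle _ t At))// (le_trans ((svalP t).1.1 x y))//.
        by rewrite addrC lerD2l st.
      rewrite (le_trans (Sle _ s As))// (le_trans ((svalP s).1.1 x y))//.
      by rewrite addrC lerD2r ts.
    have := a0; rewrite le0r => /predU1P[->|{}a0'].
      rewrite scale0r mul0r (le_trans (Sle _ _ Aq0))//.
      by rewrite (sublinear0 (svalP q0).1).
    rewrite -ler_pdivrMl//; apply: (leS) => t At; rewrite ler_pdivrMl//.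
    by rewrite (le_trans (Sle _ t At))// (svalP t).1.2.
  have Sp x : inf (S x) <= p x by rewrite (le_trans (Sle x _ Aq0))// (svalP q0).2.
  exists (exist _ (fun x => inf (S x)) (conj sS Sp)) => t At.
  by apply/asboolP => x /=; exact: Sle.
exists q => //; split=> // r sr rq.
have rp x : r x <= p x by rewrite (le_trans (rq x)).
by have /(congr1 sval) := qmax (exist _ r (conj sr rp)) (asboolT rq).
Qed.

(** A linear form below [infconv p K] satisfies all the constraints at once. *)
Lemma mazur_orlicz p K : sublinear p -> convex_cone K ->
  (forall u, K u -> 0 <= p (- u.1) + u.2) ->
  exists f : {linear V -> R^o},
    (forall x, f x <= p x) /\ (forall u, K u -> f u.1 <= u.2).
Proof.
move=> sp coneK pK.
have [f fmin fle] := sublinear_minimal_exists _ (infconv_sublinear sp coneK pK).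
pose F : {linear V -> R^o} := HB.pack (f : V -> R^o)
  (GRing.isLinear.Build _ _ _ _ _ (sublinear_minimal_linear _ fmin)).
exists F; split=> [x|u Ku]; apply: le_trans (fle _) _.
  exact: infconv_le_base.
exact: infconv_le_graph.
Qed.

End Sublinear.

(** * Separation of a point from a convex cone *)

Section ConeSeparation.
Context {R : realType}.

Lemma norm_sublinear {V : normedModType R} : sublinear (fun x : V => `|x|).
Proof.
by split=> [x y|a x a0]; [exact: ler_normD|rewrite normrZ ger0_norm].
Qed.

Lemma dual_of_le_norm {V : normedModType R} (f : {linear V -> R^o}) :
  (forall x, f x <= `|x|) -> exists g : dual_space V, forall x, g x = f x.
Proof.
move=> f1.
have f_norm x : `|f x| <= `|x|.
  by rewrite ler_norml f1 andbT lerNl -linearN -normrN f1.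
have fP : (f : V -> R^o) \in @continuous_linear R V.
  apply/asboolP; split; first exact: linearP.
  apply/(linear_bounded_continuous f)/bounded_funP => r.
  by exists r => x xr; exact: le_trans (f_norm x) xr.
by exists (DualSpace fP).
Qed.

(** With [d] the positive distance from [x0] to [C], the constraints [f k <= 0]
    for [k] in [C] and [f (- x0) <= - d] generate a cone of constraints. It is
    compatible with the norm because [t * d <= `|t *: x0 - k|], which for [0 < t]
    is the distance bound at [t^-1 *: k]. *)
Lemma separate_cone {V : normedModType R} (C : set V) (x0 : V) :
  convex_cone C -> ~ closure C x0 ->
  exists f : dual_space V, (forall k, C k -> f k <= 0) /\ 0 < f x0.
Proof.
move=> [C0 CD CZ] x0C.
have [d d0 Cd] : exists2 d : R, 0 < d & forall k, C k -> d <= `|x0 - k|.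
  apply: contrapT => noD; apply: x0C => B /nbhs_ballP[d /= d0 dB].
  apply: contrapT => noC; apply: noD; exists d => // k Ck.
  rewrite leNgt; apply/negP => kd; apply: noC; exists k; split=> //.
  by apply: dB; rewrite -ball_normE.
pose K : set (V * R^o) := [set u | exists k t,
  [/\ C k, 0 <= t & u = (k - t *: x0, - (t * d))]].
have coneK : convex_cone K.
  split.
  - by exists 0, 0; split=> //; rewrite scale0r subr0 mul0r oppr0.
  - move=> _ _ [k [s [Ck s0 ->]]] [l [t [Cl t0 ->]]] /=.
    exists (k + l), (s + t); split; [exact: CD|exact: addr_ge0|].
    by rewrite scalerDl mulrDl !opprD addrACA.
  - move=> a _ a0 [k [t [Ck t0 ->]]] /=.
    exists (a *: k), (a * t); split; [exact: CZ|exact: mulr_ge0|].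
    rewrite -[LHS]/(a *: (k - t *: x0), a * - (t * d)).
    by rewrite scalerBr mulrN scalerA mulrA.
have normK u : K u -> 0 <= `|- u.1| + u.2.
  move=> [k [t [Ck + ->]]] /=; rewrite subr_ge0 opprB.
  rewrite le0r => /predU1P[->|t0]; first by rewrite mul0r.
  have -> : t *: x0 - k = t *: (x0 - t^-1 *: k).
    by rewrite scalerBr scalerA mulfV ?gt_eqF// scale1r.
  rewrite normrZ gtr0_norm// ler_pM2l// Cd//.
  by apply: CZ => //; rewrite invr_ge0 ltW.
have [F [F1 FK]] := mazur_orlicz _ _ norm_sublinear coneK normK.
have [f fF] := dual_of_le_norm F F1.
exists f; split=> [k Ck|]; rewrite fF.
  apply: (FK (k, 0)); exists k, 0.
  by split=> //; rewrite scale0r subr0 mul0r oppr0.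
have /FK/= : K (- x0, - d).
  by exists 0, 1; split=> //; rewrite scale1r sub0r mul1r.
by rewrite linearN lerN2; exact: lt_le_trans.
Qed.

End ConeSeparation.

(** * Closures of cones in the dual space *)

Section DualCones.
Context {R : realType}.
Context {X : normedModType R}.
Implicit Types (G : set (dual_space X)) (f : dual_space X).

Lemma cone_le0 G x f : (forall g, G g -> g x <= 0) -> cone G f -> f x <= 0.
Proof.
move=> Gx [n [r [s [r0 Gs ->]]]].
have -> : (\sum_(i < n) r i *: s i) x = \sum_(i < n) r i * s i x.
  exact: (raddf_sum (canonical_embedding x)).
by apply: sumr_le0 => i _; rewrite mulr_ge0_le0// Gx.
Qed.

Lemma weak_star_eval_continuous (x : X) :
  continuous (fun f : weak_star X => (f : dual_space X) x).
Proof.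
move=> f.
apply: (@continuous_comp (weak_star X) {ptws X -> R^o} R
  (fun f => (f : dual_space X) : X -> R^o) (@proj X (fun=> R^o) x)).
  exact: initial_continuous.
exact: proj_continuous.
Qed.

(** The sets that contain every function close to [f] on some finite set of points
    form a filter. It converges pointwise to [f], hence it contains all
    neighbourhoods of [f] in the product topology. *)
Lemma weak_star_nbhs f (B : set (weak_star X)) : nbhs (f : weak_star X) B ->
  exists (s : seq X) (e : R), 0 < e /\
    forall g : dual_space X,
      (forall x, x \in s -> `|f x - g x| < e) -> B g.
Proof.
move=> [_ [[U oU <-] Uf UB]].
pose F : set_system (X -> R^o) := fun A => exists (s : seq X) (e : R), 0 < e /\
    forall g, (forall x, x \in s -> `|f x - g x| < e) -> A g.
have FF : Filter F.
  split.
  - by exists [::], 1.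
  - move=> A A' [s [e [e0 sA]]] [s' [e' [e0' sA']]].
    exists (s ++ s'), (Num.min e e'); split; first by rewrite lt_min e0.
    move=> g sg; split; [apply: sA|apply: sA'] => x xs.
      by have := sg x; rewrite mem_cat xs => /(_ isT); rewrite lt_min => /andP[].
    by have := sg x; rewrite mem_cat xs orbT => /(_ isT); rewrite lt_min => /andP[].
  - by move=> A A' AA' [s [e [e0 sA]]]; exists s, e; split=> // g /sA/AA'.
have /pointwise_cvgP Ff : forall t, (fun g : X -> R^o => g t) @ F --> f t.
  move=> t A /nbhs_ballP[e /= e0 eA]; exists [:: t], e; split=> // g sg.
  by apply: eA; rewrite -ball_normE/=; apply: sg; rewrite mem_head.
have [s [e [e0 sU]]] := Ff _ (open_nbhs_nbhs (conj oU Uf)).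
by exists s, e; split=> // g sg; apply: UB; exact: sU.
Qed.

Section Evaluations.
Variable (s : seq X).

Definition evaluations (g : dual_space X) : 'rV[R]_(size s) :=
  \row_i g (tnth (in_tuple s) i).

Lemma evaluations_linear : linear evaluations.
Proof. by move=> a g h; apply/rowP => i; rewrite !mxE. Qed.

Lemma evaluations_convex_cone (C : set (dual_space X)) :
  convex_cone C -> convex_cone (evaluations @` C).
Proof.
pose T : {linear dual_space X -> 'rV[R]_(size s)} :=
  HB.pack evaluations (GRing.isLinear.Build _ _ _ _ _ evaluations_linear).
move=> [C0 CD CZ]; split.
- by exists 0 => //; exact: (linear0 T).
- by move=> _ _ [g Cg <-] [h Ch <-]; exists (g + h); [exact: CD|exact: (linearD T)].
- by move=> a _ a0 [g Cg <-]; exists (a *: g); [exact: CZ|exact: (linearZZ T)].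
Qed.

(** The values of [F] on the standard basis are the coefficients of the point on
    the entries of [s]. *)
Lemma dual_evaluations (F : dual_space 'rV[R]_(size s)) :
  exists x : X, forall g, F (evaluations g) = g x.
Proof.
exists (\sum_i F (delta_mx 0 i) *: tnth (in_tuple s) i) => g.
rewrite [evaluations g]row_sum_delta !linear_sum.
by apply: eq_bigr => i _; rewrite !linearZ/= mxE [LHS]mulrC.
Qed.

End Evaluations.

(** If no element of the cone is close to [f] on [s], the row of values of [f]
    is not in the closure of the rows coming from the cone, since the norm on rows
    is the maximum of the coordinates; separating it from them gives
    a point where the cone is nonpositive and [f] is positive. *)
Lemma weak_star_closure_cone G f :
  (forall x, (forall g, G g -> g x <= 0) -> f x <= 0) ->
  weak_star_closure (cone G) f.
Proof.
move=> Gf B /weak_star_nbhs[s [e [e0 sB]]].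
have [fC|fC] := pselect (closure (evaluations s @` cone G) (evaluations s f)).
  have [_ [[g Gg <-]]] := fC _ (nbhsx_ballx _ _ e0).
  move=> [_ ball_g].
  exists g; split=> //; apply: sB => x /(tnthP (in_tuple s))[i ->].
  by have := ball_g 0 i; rewrite -ball_normE /= !mxE.
have [F [FG Ff]] :=
  separate_cone _ _ (evaluations_convex_cone s _ (cone_convex G)) fC.
have [x Fx] := dual_evaluations s F.
suff : f x <= 0 by rewrite leNgt -Fx Ff.
by apply: Gf => g Gg; rewrite -Fx; apply: FG; exists g => //; exact: sub_cone.
Qed.

Lemma closure_cone_of_reflexive G f : reflexive_space X ->
  (forall x, (forall g, G g -> g x <= 0) -> f x <= 0) -> closure (cone G) f.
Proof.
move=> reflX Gf; apply: contrapT => fC.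
have [F [FG Ff]] := separate_cone _ _ (cone_convex G) fC.
have [x _ xF] : range (@canonical_embedding R X) F by rewrite reflX.
suff : f x <= 0 by rewrite leNgt; move: Ff; rewrite -xF => ->.
by apply: Gf => g /sub_cone/FG; rewrite -xF.
Qed.

Lemma closure_le0 {T : topologicalType} (u : T -> R) (A : set T) (t : T) :
  continuous u -> (forall y, A y -> u y <= 0) -> closure A t -> u t <= 0.
Proof.
move=> cu Au clA; have clu : closed (u @^-1` [set y | y <= 0]).
  by apply: preimage_closed => [y _|]; [exact: cu|exact: closed_le].
exact/clu/(closure_subset _ clA).
Qed.

Lemma le0_weak_star_closure G f x : weak_star_closure (cone G) f ->
  (forall g, G g -> g x <= 0) -> f x <= 0.
Proof.
move=> clG Gx.
apply: (@closure_le0 (weak_star X) (fun g => (g : dual_space X) x) (cone G) f).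
- exact: weak_star_eval_continuous.
- by move=> g; exact: cone_le0.
- exact: clG.
Qed.

Lemma le0_closure G f x : closure (cone G) f ->
  (forall g, G g -> g x <= 0) -> f x <= 0.
Proof.
move=> clG Gx.
apply: (@closure_le0 (dual_space X) (canonical_embedding x) (cone G) f) => //.
- exact: dual_continuous.
- by move=> g; exact: cone_le0.
Qed.

Lemma positive_relativeP G f : positive_relative G f <->
  (forall x, (forall g, G g -> g x <= 0) -> f x <= 0).
Proof.
by split=> Gf x Gx; have := Gf (- x); rewrite linearN ?oppr_ge0 ?oppr_le0; apply;
  move=> g /Gx; rewrite linearN ?oppr_ge0 ?oppr_le0.
Qed.

End DualCones.

(** * The bipolar characterization of cones in the dual space *)

Theorem theorem2p4 (R : realType) (X : normedModType R)
    (Gamma : set (dual_space X)) (xstar : dual_space X) :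
  [<-> positive_relative Gamma xstar;
       negative_relative Gamma xstar;
       dual_cone Gamma `<=` dual_cone [set xstar];
       weak_star_closure (cone Gamma) xstar]
  /\
  (reflexive_space X ->
   [<-> positive_relative Gamma xstar;
        negative_relative Gamma xstar;
        dual_cone Gamma `<=` dual_cone [set xstar];
        weak_star_closure (cone Gamma) xstar;
        closure (cone Gamma) xstar]).
Proof.
have neg_dual : negative_relative Gamma xstar ->
    dual_cone Gamma `<=` dual_cone [set xstar].
  by move=> neg x Gx _ ->; exact: neg.
have dual_neg : dual_cone Gamma `<=` dual_cone [set xstar] ->
    negative_relative Gamma xstar.
  by move=> sub x /sub; exact.
split=> [|reflX]; tfae.
- by move/positive_relativeP.
- exact: neg_dual.
- by move/dual_neg/weak_star_closure_cone.
- by move=> clw; apply/positive_relativeP => x; exact: le0_weak_star_closure.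
- by move/positive_relativeP.
- exact: neg_dual.
- by move/dual_neg/weak_star_closure_cone.
- move=> clw; apply: closure_cone_of_reflexive => // x.
  exact: le0_weak_star_closure.
- by move=> cl; apply/positive_relativeP => x; exact: le0_closure.
Qed.
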